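(* Let $E,Z$ be Banach spaces, $D$ a normed linear space, $X\subset E$ a closed convex set, $Y\subset D$ a discrete set (every point of $Y$ is isolated in $Y$), $K\subset Z$ a closed convex cone with nonempty interior, and let $f:X\times Y\to\mathbb{R}$, $g:X\times Y\to Z$ be such that, for each $y\in Y$, $f(\cdot,y)$ is convex and $g(\cdot,y)$ is $K$-convex on $X$. Let $V:=\{y\in Y:g(x,y)\preceq_K0\text{ for some }x\in X\}$, and assume the Slater condition: for every $y\in V$ there is $\hat x\in X$ with $g(\hat x,y)\prec_K0$. Suppose that $X$ and $Y$ are compact and that $f$ and $g$ are continuous on $X\times Y$. For $y\in V$ let $U(y)$ be the set of all optimal Lagrange multipliers of the problem $P(y)$: minimize $f(x,y)$ subject to $x\in X$, $g(x,y)\preceq_K0$; suppose that the set-valued mapping $y\mapsto U(y)$ is locally bounded on $V$. Then for any given $\varepsilon>0$, the generalized Benders decomposition algorithm (Algorithm 1, described in the context) for the problem of minimizing $f(x,y)$ subject to $g(x,y)\preceq_K0$, $x\in X$, $y\in Y$, terminates in a finite number of steps.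
   Context: Order notation: $z_1\preceq_K z_2$ means $z_2-z_1\in K$; $z_1\prec_K z_2$ means $z_2-z_1\in\mathrm{int}(K)$. A map $\varphi:X\to Z$ is $K$-convex if $\varphi(\lambda x_1+(1-\lambda)x_2)\preceq_K\lambda\varphi(x_1)+(1-\lambda)\varphi(x_2)$ for all $x_1,x_2\in X$, $\lambda\in[0,1]$. $K^+:=\{z^*\in Z^*:\langle z^*,z\rangle\ge0\ \forall z\in K\}$. $v_y(0):=\inf\{f(x,y):x\in X,\ g(x,y)\preceq_K0\}$ with $\inf\emptyset=+\infty$. $\bar u^*\in Z^*$ is an optimal Lagrange multiplier for $P(y)$ if there is $\bar x\in X$ such that: (i) $f(\bar x,y)+\langle\bar u^*,g(\bar x,y)\rangle=\min_{x\in X}\{f(x,y)+\langle\bar u^*,g(x,y)\rangle\}$; (ii) $\langle\bar u^*,g(\bar x,y)\rangle=0$; (iii) $\bar u^*\in K^+$; (iv) $g(\bar x,y)\preceq_K0$. $U$ is locally bounded at $y\in V$ if there are $\delta,M\in(0,+\infty)$ such that $\|u^*\|\le M$ for all $y'\in V$ with $\|y'-y\|<\delta$ and all $u^*\in U(y')$. Algorithm 1, with tolerance $\varepsilon>0$. Step 1: Take $y_1\in V$ and $z_1^*\in K^+$ with $\|z_1^*\|=1$. Solve $P(y_1)$ and obtain an optimal Lagrange multiplier $u_1^*$ of $P(y_1)$. Set $T^1=S^1:=\{1\}$, $\mathrm{UBD}^1:=v_{y_1}(0)$, $k:=1$. Step 2: Let $(y_{k+1},\eta_{k+1})$ be an optimal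 solution of the relaxed master problem: minimize $\eta$ over $y\in Y$, $\eta\in\mathbb{R}$ subject to $\eta\ge\inf_{x\in X}\{f(x,y)+\langle u_i^*,g(x,y)\rangle\}$ for all $i\in T^k$ and $\inf_{x\in X}\langle z_j^*,g(x,y)\rangle\le0$ for all $j\in S^k$. If $\mathrm{UBD}^k\le\eta_{k+1}+\varepsilon$, terminate; otherwise go to Step 3. Step 3: Solve $P(y_{k+1})$. (a) If $v_{y_{k+1}}(0)<+\infty$: if $v_{y_{k+1}}(0)\le\eta_{k+1}+\varepsilon$, terminate; otherwise determine an optimal Lagrange multiplier $u_{k+1}^*$ of $P(y_{k+1})$, and let $T^{k+1}:=T^k\cup\{k+1\}$, $S^{k+1}:=S^k$, $\mathrm{UBD}^{k+1}:=\min\{\mathrm{UBD}^k,v_{y_{k+1}}(0)\}$. Set $k:=k+1$ and return to Step 2. (b) If $v_{y_{k+1}}(0)=+\infty$ (i.e. $P(y_{k+1})$ is infeasible): take $z_{k+1}^*\in K^+$ with $\|z_{k+1}^*\|=1$ and $\inf_{x\in X}\langle z_{k+1}^*,g(x,y_{k+1})\rangle>0$; let $T^{k+1}:=T^k$, $S^{k+1}:=S^k\cup\{k+1\}$, $\mathrm{UBD}^{k+1}:=\mathrm{UBD}^k$. Set $k:=k+1$ and return to Step 2. ''Terminates in a finite number of steps'' means that every execution of the algorithm, whatever admissible choices are made, stops after finitely many iterations. *)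

(* Defs.v *)
From HB Require Import structures.
From mathcomp Require Import all_boot all_order all_algebra.
From mathcomp Require Import all_classical all_reals all_analysis.

Set Implicit Arguments.
Unset Strict Implicit.
Unset Printing Implicit Defensive.

Import Order.TTheory GRing.Theory Num.Theory.
Import numFieldNormedType.Exports.

Local Open Scope classical_set_scope.
Local Open Scope ring_scope.

Section Dual.
Context {R : realType} {Z : normedModType R}.

Record dual := Dual {
  dual_fun :> {linear Z -> R^o} ;
  dual_continuous : continuous dual_fun }.

(* The set is nonempty, and bounded because the functional is continuous, so
   the real [sup] is the true supremum. *)
Definition dual_norm (u : dual) : R :=
  sup [set `|u z| | z in [set z : Z | `|z| <= 1]].

End Dual.
Arguments dual {R} Z.

Section Cone.
Context {R : realType} {Z : normedModType R}.
Implicit Types (K : set Z).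

Definition is_cone K := forall (t : R) z, 0 <= t -> K z -> K (t *: z).

Definition cone_le K (z1 z2 : Z) := K (z2 - z1).

Definition cone_lt K (z1 z2 : Z) := interior K (z2 - z1).

Definition dual_cone K : set (dual Z) := [set u | forall z, K z -> 0 <= u z].

Definition cone_convex K (E : normedModType R) (X : set E) (phi : E -> Z) :=
  forall x1 x2 (t : R), X x1 -> X x2 -> 0 <= t -> t <= 1 ->
    cone_le K (phi (t *: x1 + (1 - t) *: x2))
              (t *: phi x1 + (1 - t) *: phi x2).

End Cone.

Definition locally_bounded_at {R : realType} {D Z : normedModType R}
    (V : set D) (U : D -> set (dual Z)) (y : D) :=
  exists delta M : R, [/\ 0 < delta, 0 < M &
    forall y', V y' -> `|y' - y| < delta ->
    forall u, U y' u -> dual_norm u <= M].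

Section Benders.
Context {R : realType} {E Z : completeNormedModType R} {D : normedModType R}.
(* [f] and [g] are total; only their values on [X `*` Y] are ever used. *)
Variables (X : set E) (Y : set D) (K : set Z).
Variables (f : E -> D -> R) (g : E -> D -> Z).

Definition feasible_set (y : D) : set E :=
  [set x | X x /\ cone_le K (g x y) 0].

Definition feasible_params : set D :=
  [set y | Y y /\ exists x, feasible_set y x].

(* v_y(0); [ereal_inf set0 = +oo] *)
Definition value (y : D) : \bar R :=
  ereal_inf [set (f x y)%:E | x in feasible_set y].

Definition lagrangian (u : dual Z) (x : E) (y : D) : R := f x y + u (g x y).

Definition multipliers (y : D) : set (dual Z) := [set u |
  exists2 xbar, X xbar &
  [/\ forall x, X x -> lagrangian u xbar y <= lagrangian u x y,
      u (g xbar y) = 0,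
      dual_cone K u &
      cone_le K (g xbar y) 0]].

(* [opt_idx] and [feas_idx] are the index sets T^k and S^k of the cuts;
   [ustar i] and [zstar j] are meaningful only for [i] in [opt_idx] and [j] in
   [feas_idx]. *)
Record state := State {
  iter_nb : nat ;
  opt_idx : set nat ;
  feas_idx : set nat ;
  ustar : nat -> dual Z ;
  zstar : nat -> dual Z ;
  UBD : \bar R }.

Definition master_feasible (s : state) (y : D) (eta : R) :=
  [/\ Y y,
      forall i, opt_idx s i ->
        (ereal_inf [set (lagrangian (ustar s i) x y)%:E | x in X] <= eta%:E)%E &
      forall j, feas_idx s j ->
        (ereal_inf [set (zstar s j (g x y))%:E | x in X] <= 0)%E].

Definition master_optimal (s : state) (y : D) (eta : R) :=
  master_feasible s y eta /\
  forall y' eta', master_feasible s y' eta' -> eta <= eta'.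

(* Control points of the algorithm. [Step1 y1 z1] is the point of Step 1 at
   which [y1] and [z1] have been taken and the multiplier is still to be
   found; [Step3 s y eta] carries the solution of the master problem found in
   Step 2. *)
Inductive config :=
  | Step1 of D & dual Z
  | Step2 of state
  | Step3 of state & D & R
  | Terminated.

Definition initial (c : config) := exists y1 z1,
  [/\ feasible_params y1, dual_cone K z1, dual_norm z1 = 1 & c = Step1 y1 z1].

Definition start_state (y1 : D) (z1 u1 : dual Z) : state :=
  State 1 [set 1%N] [set 1%N] (fun=> u1) (fun=> z1) (value y1).

Definition add_optimality_cut (s : state) (y : D) (w : dual Z) : state :=
  let k1 := (iter_nb s).+1 in
  State k1 (opt_idx s `|` [set k1]) (feas_idx s) [eta ustar s with k1 |-> w] (zstar s)
    (Order.min (UBD s) (value y)).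

Definition add_feasibility_cut (s : state) (w : dual Z) : state :=
  let k1 := (iter_nb s).+1 in
  State k1 (opt_idx s) (feas_idx s `|` [set k1]) (ustar s) [eta zstar s with k1 |-> w] (UBD s).

Variable eps : R.

Inductive transition : config -> config -> Prop :=
  | Step1_multiplier y1 z1 u1 :
      multipliers y1 u1 ->
      transition (Step1 y1 z1) (Step2 (start_state y1 z1 u1))
  | Step2_stop s y eta :
      master_optimal s y eta ->
      (UBD s <= (eta + eps)%:E)%E ->
      transition (Step2 s) Terminated
  | Step2_continue s y eta :
      master_optimal s y eta ->
      ~ (UBD s <= (eta + eps)%:E)%E ->
      transition (Step2 s) (Step3 s y eta)
  | Step3a_stop s y eta :
      (value y < +oo)%E ->
      (value y <= (eta + eps)%:E)%E ->
      transition (Step3 s y eta) Terminated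
  | Step3a_continue s y eta w :
      (value y < +oo)%E ->
      ~ (value y <= (eta + eps)%:E)%E ->
      multipliers y w ->
      transition (Step3 s y eta) (Step2 (add_optimality_cut s y w))
  | Step3b s y eta w :
      value y = +oo%E ->
      dual_cone K w ->
      dual_norm w = 1 ->
      (0 < ereal_inf [set (w (g x y))%:E | x in X])%E ->
      transition (Step3 s y eta) (Step2 (add_feasibility_cut s w)).

(* A maximal execution, presented as an infinite sequence: once no transition
   is possible, the last configuration is repeated forever. This happens at
   [Terminated], but it would also happen at a configuration where the next
   object requested by the algorithm did not exist. *)
Definition execution (c : nat -> config) :=
  initial (c 0%N) /\
  forall n, transition (c n) (c n.+1) \/
    ((forall c', ~ transition (c n) c') /\ c n.+1 = c n).

(* Every execution reaches a terminating instruction; in particular it neither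
   runs forever nor gets stuck. *)
Definition terminates_finitely :=
  forall c, execution c -> exists n, c n = Terminated.

End Benders.

(* Main.v *)
(* A compact discrete set is finite, so it suffices that no parameter produces
   two cuts and that every step can be carried out. An optimality cut at y forces
   every later eta at y up to the value of P(y), by strong duality at the
   multiplier, and a feasibility cut makes y infeasible for the master problem;
   hence a repeated master solution triggers the stopping test. Multipliers and
   infeasibility certificates exist by a separation argument: a maximal convex
   cone avoiding -e, for e interior to K, yields a functional positive on it. *)
Require Import Defs.
From HB Require Import structures.
From mathcomp Require Import all_boot all_order all_algebra.
From mathcomp Require Import all_classical all_reals all_analysis.
From mathcomp Require Import finmap ring lra.
Import Order.TTheory GRing.Theory Num.Theory.
Import numFieldNormedType.Exports.
Local Open Scope classical_set_scope.
Local Open Scope ring_scope.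
Set Implicit Arguments.
Unset Strict Implicit.
Unset Printing Implicit Defensive.

(** * Convex cones and separation in real vector spaces *)

Definition convex_cone (R : realType) (V : lmodType R) (P : set V) :=
  (forall x y, P x -> P y -> P (x + y)) /\
  (forall (t : R) x, 0 <= t -> P x -> P (t *: x)).

(** Zorn's lemma gives a maximal [Q]. If [x] is outside [Q], the cone generated by [Q] and [x] must
    contain [- e], so [- e = q + t *: x] with [t > 0], and solving for [- x] gives a positive
    multiple of [q + e]. *)
Lemma maximal_convex_cone (R : realType) (V : lmodType R) (P : set V) (e : V) :
  convex_cone P -> P e -> ~ P (- e) ->
  exists Q, [/\ convex_cone Q, P `<=` Q, ~ Q (- e) &
    forall x, ~ Q x -> Q (- x)].
Proof.
move=> cP Pe Pne.
pose F (A : set V) := A = set0 \/ [/\ convex_cone A, P `<=` A & ~ A (- e)].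
have [G GF tG|Q [FQ maxQ]] := @Zorn_bigcup V F.
  have [[A [GA [cA PA nA]]]|noA] := pselect
    (exists A, G A /\ [/\ convex_cone A, P `<=` A & ~ A (- e)]); last first.
    left; rewrite -subset0 => x [A GA Ax].
    have [A0|hA] := GF _ GA; first by rewrite A0 in Ax.
    by case: noA; exists A.
  right; split.
  - split.
      move=> x y [B GB Bx] [C GC Cy].
      wlog BC : B C x y GB GC Bx Cy / B `<=` C.
        move=> hw; have [BC|CB] := tG _ _ GB GC; first exact: (hw B C).
        by rewrite addrC; apply: (hw C B).
      exists C => //.
      have [C0|[[+ _] _ _]] := GF _ GC; first by rewrite C0 in Cy.
      by apply => //; exact: BC.
    move=> t x t0 [B GB Bx]; exists B => //.
    have [B0|[[_ +] _ _]] := GF _ GB; first by rewrite B0 in Bx.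
    exact.
  - by move=> x Px; exists A => //; exact: PA.
  - move=> [B GB Bx].
    by have [B0|[_ _]] := GF _ GB; first by rewrite B0 in Bx.
have FP : F P by right; split => //.
have [Q0|[cQ PQ nQ]] := FQ.
  exfalso; apply: (maxQ P) => //; rewrite Q0; split => //.
  by move=> /(_ _ Pe).
exists Q; split => // x nQx.
pose A := [set z | exists q t, [/\ Q q, 0 <= t & z = q + t *: x]].
have [Qadd Qsc] := cQ.
have Q0 : Q 0 by rewrite -(scale0r e); apply: Qsc => //; exact: PQ.
have QA : Q `<=` A.
  by move=> q Qq; exists q, 0; split => //; rewrite scale0r addr0.
have [[q [t [Qq t0 et]]]|nA] := pselect (A (- e)).
  have tp : 0 < t.
    rewrite lt_neqAle t0 andbT; apply/eqP => t0'.
    by move: et; rewrite -t0' scale0r addr0 => et; apply: nQ; rewrite et.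
  have -> : - x = t^-1 *: (q + e).
    rewrite -[e]opprK et opprD addNKr scalerN scalerA mulVf ?gt_eqF//.
    by rewrite scale1r.
  apply: Qsc; first by rewrite invr_ge0.
  by apply: Qadd => //; exact: PQ.
exfalso; apply: (maxQ A).
  split=> //; move=> /(_ x) AQ; apply: nQx; apply: AQ.
  by exists 0, 1; split => //; rewrite scale1r add0r.
right; split => //; last by move=> z Pz; apply: QA; exact: PQ.
split.
  move=> _ _ [q [t [Qq t0 ->]]] [q' [t' [Qq' t0' ->]]].
  exists (q + q'), (t + t'); split; [exact: Qadd|exact: addr_ge0|].
  by rewrite scalerDl addrACA.
move=> s _ s0 [q [t [Qq t0 ->]]].
exists (s *: q), (s * t); split; [exact: Qsc|exact: mulr_ge0|].
by rewrite scalerDr scalerA.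
Qed.

Lemma le_of_forall_lt (R : realType) (a b : R) :
  (forall t, t < a -> t <= b) -> a <= b.
Proof.
move=> h; rewrite leNgt; apply/negP => ba.
have := h ((a + b) / 2); lra.
Qed.

(* A maximal cone [Q] avoiding [- e] induces a total preorder, for which
   [sup {t | Q (x - t e)}] is linear in [x]. *)
Lemma positive_functional (R : realType) (V : lmodType R) (P : set V) (e : V) :
  convex_cone P -> P e -> ~ P (- e) ->
  (forall x, exists t : R, P (t *: e + x)) ->
  exists2 l : {linear V -> R^o}, l e = 1 & forall x, P x -> 0 <= l x.
Proof.
move=> cP Pe Pne unitP.
have [Q [[Qadd Qsc] PQ nQ totQ]] := maximal_convex_cone cP Pe Pne.
have Q0 : Q 0 by rewrite -(scale0r e); apply: Qsc => //; exact: PQ.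
pose S x := [set t : R | Q (x - t *: e)].
pose l x := sup (S x).
(* If [s < t], adding the two memberships puts [(s - t) *: e] in [Q], hence [- e] after
   rescaling. *)
have bnd x s t : Q (s *: e - x) -> Q (x - t *: e) -> t <= s.
  move=> h1 h2; rewrite leNgt; apply/negP => st; apply: nQ.
  have := Qadd _ _ h1 h2; rewrite addrA subrK -scalerBl => h.
  have ts : 0 <= (t - s)^-1 by rewrite invr_ge0 subr_ge0 ltW.
  have := Qsc _ _ ts h; rewrite scalerA -(opprB t s) mulrN mulVf ?scaleN1r//.
  by rewrite subr_eq0 gt_eqF.
have Sne x : S x !=set0.
  by have [t ht] := unitP x; exists (- t); rewrite /S /= scaleNr opprK addrC; exact: PQ.
have Sub x s : Q (s *: e - x) -> ubound (S x) s.
  by move=> h t; exact: bnd.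
have supS x : has_sup (S x).
  split; first exact: Sne.
  by have [t ht] := unitP (- x); exists t; apply: Sub; exact: PQ.
have lub x s : Q (s *: e - x) -> l x <= s.
  by move=> h; apply: ge_sup; [exact: Sne|exact: Sub].
have llb x t : Q (x - t *: e) -> t <= l x.
  by move=> h; apply: ub_le_sup => //; case: (supS x).
(* Totality turns non-membership above the supremum into the reverse membership, so [l x] is a
   two-sided cut; this yields oddness of [l]. *)
have gtl x t : l x < t -> Q (t *: e - x).
  move=> h; rewrite -opprB; apply: totQ => /llb; lra.
have lN x : l (- x) = - l x.
  apply/eqP; rewrite eq_le; apply/andP; split.
    apply: ge_sup => // t; rewrite /S /= -opprD => h.
    suff: l x <= - t by lra.
    by apply: lub; rewrite scaleNr -opprD addrC.
  apply: le_of_forall_lt => t ht; apply: llb.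
  by have := gtl x (- t); rewrite scaleNr addrC; apply; lra.
have ltl x t : t < l x -> Q (x - t *: e).
  by have := gtl (- x) (- t); rewrite lN scaleNr opprK addrC => h ?; apply: h; lra.
have lDge x y : l x + l y <= l (x + y).
  apply: le_of_forall_lt => t ht.
  (* Half of the slack goes to each summand, so both thresholds lie strictly below [l x] and
     [l y]. *)
  pose d := (l x + l y - t) / 2.
  have h1 := ltl x (l x - d); have h2 := ltl y (t - (l x - d)).
  apply: llb; have -> : x + y - t *: e =
    (x - (l x - d) *: e) + (y - (t - (l x - d)) *: e).
    by rewrite addrACA -opprD -scalerDl subrKC.
  by apply: Qadd; [apply: h1|apply: h2]; rewrite /d; lra.
(* The converse inequality is superadditivity at [x + y] and [- y], combined with oddness. *)
have lD x y : l (x + y) = l x + l y.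
  apply/eqP; rewrite eq_le lDge andbT.
  have := lDge (x + y) (- y); rewrite addrK lN; lra.
have lZge k x : 0 < k -> k * l x <= l (k *: x).
  move=> k0; apply: le_of_forall_lt => t ht; apply: llb.
  have -> : k *: x - t *: e = k *: (x - (k^-1 * t) *: e).
    by rewrite scalerBr scalerA mulrA mulfV ?gt_eqF// mul1r.
  by apply: Qsc; [exact: ltW|apply: ltl; rewrite mulrC ltr_pdivrMr// mulrC].
have lZp k x : 0 < k -> l (k *: x) = k * l x.
  move=> k0; apply/eqP; rewrite eq_le lZge// andbT.
  have ki : 0 < k^-1 by rewrite invr_gt0.
  have := lZge k^-1 (k *: x) ki.
  by rewrite scalerA mulVf ?gt_eqF// scale1r mulrC ler_pdivrMr// mulrC.
have l0 : l 0 = 0 by have := lD 0 0; rewrite addr0; lra.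
have lZ k x : l (k *: x) = k * l x.
  have [k0|k0|->] := ltrgtP k 0; last by rewrite scale0r mul0r.
  - rewrite -[k]opprK scaleNr lN lZp ?oppr_gt0//; ring.
  - exact: lZp.
have lin : linear (l : V -> R^o) by move=> k x y; rewrite lD lZ.
pose lm := GRing.isLinear.Build R V R^o _ (l : V -> R^o) lin.
pose L : {linear V -> R^o} := HB.pack (l : V -> R^o) lm.
exists L => /=.
  apply/eqP; rewrite eq_le; apply/andP; split.
    by apply: lub; rewrite scale1r subrr.
  by apply: llb; rewrite scale1r subrr.
by move=> x Px; apply: llb; rewrite scale0r subr0; exact: PQ.
Qed.

(* The functional is positive on the convex cone generated by [phi x + K] for
   [x] in [X], to which [alt] says that [- e] does not belong. *)
Lemma gordan_alternative (R : realType) (E W : lmodType R) (X : set E)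
    (K : set W) (e : W) (phi : E -> W) :
  X !=set0 ->
  (forall x1 x2 t, X x1 -> X x2 -> 0 <= t -> t <= 1 ->
     X (t *: x1 + (1 - t) *: x2)) ->
  convex_cone K -> K e -> (forall w, exists t : R, K (t *: e + w)) ->
  (forall x1 x2 t, X x1 -> X x2 -> 0 <= t -> t <= 1 ->
     K (t *: phi x1 + (1 - t) *: phi x2 - phi (t *: x1 + (1 - t) *: x2))) ->
  (forall x s, X x -> 0 < s -> ~ K (- phi x - s *: e)) ->
  exists l : {linear W -> R^o}, [/\ l e = 1, forall w, K w -> 0 <= l w &
    forall x, X x -> 0 <= l (phi x)].
Proof.
move=> [a Xa] cX [Kadd Ksc] Ke unitK cphi alt.
have K0 : K 0 by rewrite -(scale0r e); apply: Ksc.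
(* With [- e] in [K], the order unit would put every vector in [K], against [alt] at [a]. *)
have nKe : ~ K (- e).
  move=> nKe; have [t ht] := unitK (- phi a - e).
  apply: (alt a 1 Xa) => //; rewrite scale1r.
  have [t0|t0] := leP t 0.
    have -> : - phi a - e = (t *: e + (- phi a - e)) + (- t) *: e.
      by rewrite addrAC -scalerDl subrr scale0r add0r.
    by apply: Kadd => //; apply: Ksc => //; rewrite oppr_ge0.
  have -> : - phi a - e = (t *: e + (- phi a - e)) + t *: - e.
    by rewrite scalerN addrAC subrr add0r.
  by apply: Kadd => //; apply: Ksc => //; exact: ltW.
pose P : set W := [set w | exists t x, [/\ 0 <= t, X x & K (w - t *: phi x)]].
have KP : K `<=` P.
  by move=> w Kw; exists 0, a; split => //; rewrite scale0r subr0.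
have cP : convex_cone P.
  split; last first.
    move=> s w s0 [t [x [t0 Xx Kw]]]; exists (s * t), x; split => //.
      exact: mulr_ge0.
    by rewrite -scalerA -scalerBr; exact: Ksc.
  move=> w1 w2 [t1 [x1 [t10 Xx1 Kw1]]] [t2 [x2 [t20 Xx2 Kw2]]].
  (* If both weights vanish there is nothing to normalize; otherwise the witness is the convex
     combination with weights proportional to [t1] and [t2]. *)
  have [t12|t12] := eqVneq (t1 + t2) 0.
    have t1z : t1 = 0 by lra.
    have t2z : t2 = 0 by lra.
    exists 0, a; split => //; rewrite scale0r subr0.
    by move: Kw1 Kw2; rewrite t1z t2z !scale0r !subr0; exact: Kadd.
  have t12p : 0 < t1 + t2 by rewrite lt_neqAle eq_sym t12 addr_ge0.
  pose t := t1 / (t1 + t2).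
  have t0 : 0 <= t by rewrite divr_ge0// ltW.
  have t1' : t <= 1 by rewrite ler_pdivrMr// mul1r lerDl.
  exists (t1 + t2), (t *: x1 + (1 - t) *: x2); split.
  - exact: ltW.
  - exact: cX.
  have := Ksc _ _ (ltW t12p) (cphi _ _ _ Xx1 Xx2 t0 t1').
  rewrite scalerBr scalerDr !scalerA.
  have -> : (t1 + t2) * t = t1 by rewrite /t mulrC divfK.
  have -> : (t1 + t2) * (1 - t) = t2 by rewrite /t mulrBr [_ * (_ / _)]mulrC divfK//; ring.
  set p := phi (_ + _) => h.
  have -> : w1 + w2 - (t1 + t2) *: p = (w1 - t1 *: phi x1 + (w2 - t2 *: phi x2)) +
      (t1 *: phi x1 + t2 *: phi x2 - (t1 + t2) *: p).
    by rewrite (addrACA w1) -opprD addrA addrNK.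
  by apply: (Kadd) => //; exact: Kadd.
have [||l le lP] := positive_functional cP (KP _ Ke).
(* For [t > 0], dividing by [t] gives a violation of [alt] with [s] equal to [t^-1]. *)
- move=> [t [x [t0 Xx h]]].
  have [tz|tn] := eqVneq t 0.
    by apply: nKe; move: h; rewrite tz scale0r subr0.
  have tp : 0 < t by rewrite lt_neqAle eq_sym tn.
  have ti : 0 < t^-1 by rewrite invr_gt0.
  apply: (alt x t^-1 Xx ti).
  have := Ksc _ _ (ltW ti) h.
  by rewrite scalerBr scalerA mulVf// scale1r scalerN addrC.
- by move=> w; have [t ht] := unitK w; exists t; exact: KP.
exists l; split => //.
- by move=> w /KP /lP.
- move=> x Xx; apply: lP; exists 1, x; split => //.
  by rewrite scale1r subrr.
Qed.

(** * Positive functionals and dual norms in normed spaces *)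

Section NormedSpace.
Context {R : realType} {Z : normedModType R}.
Implicit Types (K : set Z).

Lemma interior_ball K e : interior K e ->
  exists2 r : R, 0 < r & forall h, `|h| <= r -> K (e + h).
Proof.
move=> /nbhs_ballP[r /= r0 rK]; exists (r / 2); first by rewrite divr_gt0.
move=> h hr; apply: rK; rewrite -ball_normE /= opprD addNKr normrN.
by rewrite (le_lt_trans hr)// ltr_pdivrMr// ltr_pMr// ltr1n.
Qed.

(** Scaled to norm at most [r], the vector [z] is a perturbation of [e] that stays in [K]; the cone
    property undoes the scaling. *)
Lemma interior_order_unit K e : is_cone K -> interior K e ->
  forall z, exists t : R, K (t *: e + z).
Proof.
move=> cK /interior_ball[r r0 rK] z.
have z1 : 0 < `|z| + 1 by rewrite ltr_wpDl.
exists ((`|z| + 1) / r).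
have -> : ((`|z| + 1) / r) *: e + z =
    ((`|z| + 1) / r) *: (e + (r / (`|z| + 1)) *: z).
  rewrite scalerDr scalerA [X in X *: z](_ : _ = 1) ?scale1r//.
  by rewrite mulf_div [X in _ / X]mulrC divff// mulf_neq0// gt_eqF.
apply: cK; first by rewrite divr_ge0// ltW.
apply: rK; rewrite normrZ ger0_norm ?divr_ge0 ?(ltW z1) ?(ltW r0)//.
by rewrite mulrAC ler_pdivrMr// ler_pM2l// lerDl.
Qed.

(** Positivity at [e + h] and [e - h] bounds [u h] in absolute value by [u e] on a ball. Algebraic
    separation thus already produces elements of [dual Z]. *)
Lemma positive_continuous K e (u : {linear Z -> R^o}) :
  interior K e -> (forall z, K z -> 0 <= u z) -> continuous u.
Proof.
move=> /interior_ball[r r0 rK] uK.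
apply/linear_bounded_continuous/bounded_funP => s.
have ub h : `|h| <= r -> `|u h| <= u e.
  move=> hr; rewrite ler_norml.
  have /uK := rK _ hr; rewrite linearD/= => h1.
  have /rK/uK : `|- h| <= r by rewrite normrN.
  rewrite linearB/= => h2; apply/andP; split; lra.
pose c := r / (`|s| + 1).
have s1 : 0 < `|s| + 1 by rewrite ltr_wpDl.
have c0 : 0 < c by rewrite divr_gt0.
exists (u e / c) => x xs; rewrite ler_pdivlMr// mulrC.
have : `|c *: x| <= r.
  rewrite normrZ gtr0_norm// /c mulrAC ler_pdivrMr// ler_pM2l//.
  by rewrite (le_trans xs)// (le_trans (ler_norm s))// lerDl.
by move=> /ub; rewrite linearZ/= normrM (gtr0_norm c0).
Qed.

Lemma scale_dual (c : R) (u : dual Z) :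
  exists w : dual Z, forall z, w z = c * u z.
Proof.
pose w : Z -> R^o := fun z => c * u z.
have lin : linear w by move=> k x y; rewrite /w linearD linearZ/= mulrDr mulrCA.
pose L : {linear Z -> R^o} := HB.pack w (GRing.isLinear.Build R Z R^o _ w lin).
have cL : continuous L.
  move=> x; apply: (@cvgMr _ _ _ _ (dual_fun u) c (u x)).
  exact: (@dual_continuous _ _ u).
by exists (Dual cL).
Qed.

Lemma dual_bounded (u : dual Z) : has_sup [set `|u z| | z in [set z : Z | `|z| <= 1]].
Proof.
split; first by exists `|u 0|, 0 => //=; rewrite normr0.
have /linear_bounded_continuous/bounded_funP/(_ 1)[M hM] := @dual_continuous _ _ u.
by exists M => _ [z /= z1 <-]; exact: hM.
Qed.

Lemma le_dual_norm (u : dual Z) z : `|z| <= 1 -> `|u z| <= dual_norm u.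
Proof.
by move=> z1; apply: ub_le_sup; [case: (dual_bounded u)|exists z].
Qed.

(** Feasibility cuts must have norm one; the nonzero value at [z0] makes [dual_norm u] a positive
    divisor. *)
Lemma normalize_dual (u : dual Z) z0 : u z0 != 0 ->
  exists c (w : dual Z), [/\ 0 < c, forall z, w z = c * u z & dual_norm w = 1].
Proof.
move=> uz0.
have z0n : 0 < `|z0|.
  by rewrite normr_gt0; apply: contra_neq uz0 => ->; rewrite linear0.
have N0 : 0 < dual_norm u.
  apply: (@lt_le_trans _ _ `|u (`|z0|^-1 *: z0)|).
    by rewrite linearZ/= normr_gt0 mulf_neq0// invr_neq0// gt_eqF.
  by apply: le_dual_norm; rewrite normrZ normfV normr_id mulVf// gt_eqF.
have [w hw] := scale_dual (dual_norm u)^-1 u.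
have Ni : 0 < (dual_norm u)^-1 by rewrite invr_gt0.
exists (dual_norm u)^-1, w; split => //.
apply/eqP; rewrite eq_le; apply/andP; split.
  apply: ge_sup; first by case: (dual_bounded w).
  move=> _ [z z1 <-]; rewrite hw normrM gtr0_norm// mulrC ler_pdivrMr// mul1r.
  exact: le_dual_norm.
rewrite -(ler_pM2l N0) mulr1; apply: ge_sup; first by case: (dual_bounded u).
move=> _ [z /= z1 <-].
have := le_dual_norm w z1; rewrite hw normrM gtr0_norm// mulrC.
by rewrite ler_pdivrMr// mulrC.
Qed.

End NormedSpace.

(** * Elementary forms of convexity, and continuity on sections *)

Lemma convex_setP (R : realType) (V : lmodType R) (A : set V) :
  convex_set A -> forall x1 x2 (t : R), A x1 -> A x2 -> 0 <= t -> t <= 1 ->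
    A (t *: x1 + (1 - t) *: x2).
Proof.
move=> cA x1 x2 t A1 A2 t0 t1; apply: set_mem.
exact: (cA x1 x2 (Itv01 t0 t1) (mem_set A1) (mem_set A2)).
Qed.

Lemma convex_functionP (R : realType) (V : lmodType R) (A : set V) (h : V -> R) :
  convex_function A h -> forall x1 x2 (t : R), A x1 -> A x2 -> 0 <= t -> t <= 1 ->
    h (t *: x1 + (1 - t) *: x2) <= t * h x1 + (1 - t) * h x2.
Proof.
move=> cA x1 x2 t A1 A2 t0 t1.
exact: (cA (Itv01 t0 t1) x1 x2 (mem_set A1) (mem_set A2)).
Qed.

Lemma convex_is_cone (R : realType) (Z : normedModType R) (K : set Z) :
  convex_set K -> is_cone K -> convex_cone K.
Proof.
move=> cK coK; split=> [x y Kx Ky|t x t0 Kx]; last exact: coK.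
have -> : x + y = 2 *: (2^-1 *: x + (1 - 2^-1) *: y).
  rewrite scalerDr !scalerA mulfV ?pnatr_eq0// scale1r.
  by rewrite [X in X *: y](_ : _ = 1) ?scale1r//; lra.
by apply: coK => //; apply: convex_setP => //; lra.
Qed.

Lemma continuous_within_section (R : realType) (E D W : normedModType R)
    (X : set E) (Y : set D) (h : E -> D -> W) y :
  {within X `*` Y, continuous (fun p : E * D => h p.1 p.2)} -> Y y ->
  {within X, continuous (fun x => h x y)}.
Proof.
move=> /subspace_continuousP hc Yy; apply/subspace_continuousP => x Xx.
have := hc (x, y) (conj Xx Yy).
apply: cvg_trans.
move=> A /= hA.
have {}hA : \forall p \near nbhs (x, y), (X `*` Y) p -> A (h p.1 p.2) by exact: hA.
move: hA => [[B C] /= [Bx Cy] BC].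
suff : \forall x' \near x, X x' -> A (h x' y) by [].
near=> x' => Xx'.
apply: (BC (x', y)) => //; split => /=; last exact: nbhs_singleton.
by near: x'.
Unshelve. all: by end_near. Qed.

(** * Compactness and the constraint set *)

Section Constraint.
Context {R : realType} {E Z : normedModType R}.
Variables (X : set E) (K : set Z) (h : E -> Z).
Hypothesis X_closed : closed X.
Hypothesis X_compact : compact X.
Hypothesis K_closed : closed K.
Hypothesis h_cont : {within X, continuous h}.

Lemma feasible_compact : compact (X `&` [set x | K (- h x)]).
Proof.
apply: (subclosed_compact _ X_compact (@subIsetl _ _ _)).
have hN : continuous ((fun x => - h x) : subspace X -> Z).
  by move=> x; apply: cvgN; exact: h_cont.
have := (continuous_closedP _).1 hN _ K_closed.
move=> /closed_subspaceP[V cV VX].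
have -> : X `&` [set x | K (- h x)] = V `&` X by rewrite setIC -VX.
exact: closedI.
Qed.

(** Each [- h x] has a ball outside the closed set [K], and compactness of [X] makes the margin
    uniform. This margin later keeps the infimum of a certificate away from zero. *)
Lemma infeasible_shift e : (forall x, X x -> ~ K (- h x)) ->
  exists2 d, 0 < d & forall x, X x -> ~ K (d *: e - h x).
Proof.
move=> inf.
have nc := (compact_near_coveringP X).1 X_compact R (0^'+)
  (fun d x => X x -> ~ K (d *: e - h x)) _.
have hd : \forall d \near 0^'+, X `<=` [set x | X x -> ~ K (d *: e - h x)].
  apply: nc => x Xx.
  have /nbhs_ballP[r /= r0 rK] : nbhs (- h x) (~` K).
    by apply: open_nbhs_nbhs; split; [exact: closed_openC|exact: inf].
  have r2 : 0 < r / 2 by rewrite divr_gt0.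
  (* One half of the radius absorbs the variation of [h], the other the shift along [e]. *)
  exists ([set x' | X x' -> `|h x - h x'| < r / 2], [set d | `|d *: e| < r / 2]).
    split => /=.
      have /subspace_continuousP/(_ _ Xx)/cvgrPdist_lt/(_ _ r2) := h_cont.
      exact.
    have c0 : (fun d : R => d *: e) @ 0^'+ --> (0 : R) *: e.
      by apply: cvgZr_tmp; exact: cvg_at_right_filter.
    have := c0; rewrite scale0r => /cvgr0Pnorm_lt; exact.
  move=> [x' d] /= [h1 h2] Xx' Kd; apply: (rK (d *: e - h x')) => //.
  rewrite -ball_normE /=.
  have -> : - h x - (d *: e - h x') = - ((h x - h x') + d *: e).
    by rewrite opprB [RHS]opprD opprB -addrA [RHS]addrCA.
  rewrite normrN (le_lt_trans (ler_normD _ _))//.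
  by have := h1 Xx'; lra.
have [d [hd' d0]] := filter_ex (filterI hd (nbhs_right_gt (0 : R))).
by exists d => // x Xx; exact: hd'.
Qed.

End Constraint.

(** * Existence of multipliers and of infeasibility certificates *)

Section Duality.
Context {R : realType} {E Z : completeNormedModType R} {D : normedModType R}.
Variables (X : set E) (Y : set D) (K : set Z) (f : E -> D -> R) (g : E -> D -> Z).
Hypotheses (X_closed : closed X) (X_convex : convex_set X) (X_compact : compact X).
Hypotheses (K_closed : closed K) (K_convex : convex_set K) (K_cone : is_cone K).
Variables (e : Z) (y : D).
Hypotheses (Ke : interior K e) (f_convex : convex_function X (fun x => f x y)).
Hypothesis g_convex : cone_convex K X (fun x => g x y).
Hypothesis f_cont : {within X, continuous (fun x => f x y)}.
Hypothesis g_cont : {within X, continuous (fun x => g x y)}.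

Lemma multiplier_exists xhat x0 : X xhat -> cone_lt K (g xhat y) 0 ->
  feasible_set X K g y x0 -> exists u, multipliers X K f g y u.
Proof.
move=> Xxhat slater [Xx0 gx0].
have [Kadd Ksc] := convex_is_cone K_convex K_cone.
have Ke' : K e := interior_subset Ke.
have [xbar /set_mem[Xxbar /= gxbar] fmin] :
    exists2 c, c \in X `&` [set x | K (- g x y)] &
      forall t, t \in X `&` [set x | K (- g x y)] -> f c y <= f t y.
  apply: compact_EVT_min.
  - by exists x0; split => //=; rewrite -sub0r.
  - exact: feasible_compact.
  - by apply: continuous_subspaceW f_cont => x [].
pose v := f xbar y.
(* The alternative is applied to [(f - v, g)] and the cone [R+ * K]; the Slater
   point makes the multiplier [lam] of the objective positive. *)
pose W := (R^o * Z)%type.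
pose K' : set W := [set w | 0 <= (w.1 : R) /\ K w.2].
pose e' : W := (1, e).
pose phi x : W := (f x y - v, g x y).
have [|||||l [le lK lphi]] := @gordan_alternative R E W X K' e' phi
  (ex_intro _ xhat Xxhat) (convex_setP X_convex).
- split; first by move=> [a1 b1] [a2 b2] [/= ? ?] [/= ? ?]; split; [exact: addr_ge0|exact: Kadd].
  by move=> t [a b] t0 [/= ? ?]; split; [exact: mulr_ge0|exact: Ksc].
- by split => //=.
- move=> [r z]; have [t ht] := interior_order_unit K_cone Ke z.
  (* The maximum serves both components: [- r] suffices for the first and [t] for the second. *)
  exists (Num.max t (- r)); split => /=.
    by have : - r <= Num.max t (- r); [rewrite le_max lexx orbT|rewrite /GRing.scale/=; lra].
  have -> : Num.max t (- r) *: e + z = (t *: e + z) + (Num.max t (- r) - t) *: e.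
    by rewrite addrAC -scalerDl subrKC.
  by apply: Kadd => //; apply: Ksc => //; rewrite subr_ge0 le_max lexx.
- move=> x1 x2 t X1 X2 t0 t1; split => /=.
    have := convex_functionP f_convex X1 X2 t0 t1.
    by rewrite /GRing.scale/=; lra.
  exact: g_convex.
(* A violation would be a feasible [x] with objective value below the minimum [v]. *)
- move=> x s Xx s0 [/= fx gx].
  have Kgx : K (- g x y).
    have -> : - g x y = (- g x y - s *: e) + s *: e by rewrite subrK.
    by apply: Kadd => //; apply: Ksc => //; exact: ltW.
  have : f xbar y <= f x y by apply: fmin; apply/mem_set.
  by move: fx; rewrite /v /GRing.scale/=; lra.
pose u0 : Z -> R^o := fun z => l (0, z).
have lin : linear u0.
  move=> k z1 z2; rewrite /u0.
  have -> : (0, k *: z1 + z2) = k *: ((0, z1) : W) + (0, z2).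
    by congr (_, _); rewrite /= scaler0 addr0.
  by rewrite linearD linearZ.
pose U : {linear Z -> R^o} := HB.pack u0 (GRing.isLinear.Build R Z R^o _ u0 lin).
have UK z : K z -> 0 <= U z by move=> Kz; apply: lK; split => /=.
pose u1 := Dual (positive_continuous Ke UK).
pose lam : R := l (1, 0).
have lE r z : l (r, z) = r * lam + u1 z.
  have -> : (r, z) = r *: ((1, 0) : W) + (0, z).
    by congr (_, _); rewrite /= ?scaler0 ?add0r// addr0 /GRing.scale/= mulr1.
  by rewrite linearD linearZ.
have lam0 : 0 <= lam by apply: lK; split => //=; rewrite -(scale0r e); exact: Ksc.
(* If [lam] vanished, then [u1 e = 1]; the Slater point leaves room to subtract a small multiple of
   [e], making [u1 (g xhat y)] negative, against [lphi]. *)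
have lamp : 0 < lam.
  rewrite lt_neqAle lam0 andbT; apply/eqP => lamz.
  have ue : u1 e = 1 by have := lE 1 e; rewrite -lamz mulr0 add0r le.
  have := lphi _ Xxhat; rewrite lE -lamz mulr0 add0r.
  move: slater; rewrite /cone_lt sub0r => /interior_ball[r r0 rK].
  have e1 : 0 < `|e| + 1 by rewrite ltr_wpDl.
  have s0 : 0 < r / (`|e| + 1) by rewrite divr_gt0.
  have /rK/UK : `|- ((r / (`|e| + 1)) *: e)| <= r.
    rewrite normrN normrZ gtr0_norm// mulrAC ler_pdivrMr// ler_pM2l//.
    by rewrite lerDl.
  have -> : U (- g xhat y + - ((r / (`|e| + 1)) *: e)) =
      - u1 (g xhat y) - (r / (`|e| + 1)) * u1 e.
    by rewrite linearD !linearN linearZ.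
  rewrite ue; lra.
have [u hu] := scale_dual lam^-1 u1.
have lami : 0 < lam^-1 by rewrite invr_gt0.
have uK : dual_cone K u.
  by move=> z Kz; rewrite hu mulr_ge0// ?(ltW lami)//; exact: (UK z Kz).
have lag x : X x -> v <= lagrangian f g u x y.
  move=> Xx; rewrite /lagrangian hu.
  have := lphi _ Xx; rewrite lE => h.
  have : 0 <= lam^-1 * ((f x y - v) * lam + u1 (g x y)).
    by rewrite mulr_ge0// ltW.
  rewrite mulrDr mulrC mulfK ?gt_eqF//; lra.
(* Complementarity: [lag] at [xbar] gives one sign, and feasibility of [xbar] with [u] in the dual
   cone gives the other. *)
have ug : u (g xbar y) = 0.
  have := lag _ Xxbar; rewrite /lagrangian /v.
  have := uK _ gxbar; rewrite linearN; lra.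
exists u, xbar => //; split => //; last by rewrite /cone_le sub0r.
by move=> x Xx; rewrite {1}/lagrangian ug addr0; exact: lag.
Qed.

(** The alternative is applied to [g] shifted by [d *: e], with [d] the uniform margin. Since
    [l e = 1], the functional is at least [d] along [g], and normalization only multiplies this
    bound by [c > 0]. *)
Lemma infeasibility_certificate : X !=set0 ->
  (forall x, ~ feasible_set X K g y x) ->
  exists w, [/\ dual_cone K w, dual_norm w = 1 &
    (0 < ereal_inf [set (w (g x y))%:E | x in X])%E].
Proof.
move=> X0 infeas.
have [Kadd Ksc] := convex_is_cone K_convex K_cone.
have Ke' : K e := interior_subset Ke.
have [d d0 hd] : exists2 d, 0 < d & forall x, X x -> ~ K (d *: e - g x y).
  apply: infeasible_shift => // x Xx Kg; apply: (infeas x).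
  by split => //; rewrite /cone_le sub0r.
have [|||l [le lK lphi]] := @gordan_alternative R E Z X K e
  (fun x => g x y - d *: e) X0 (convex_setP X_convex) (convex_is_cone K_convex K_cone) Ke'.
- exact: interior_order_unit.
- move=> x1 x2 t X1 X2 t0 t1.
  have := g_convex X1 X2 t0 t1; rewrite /cone_le.
  set p := g (_ + _) y; congr (K _).
  rewrite !scalerBr (addrACA (t *: g x1 y)) -opprD -scalerDl subrKC scale1r.
  by rewrite opprB addrA subrK.
- move=> x s Xx s0 Ks; apply: (hd x Xx).
  have -> : d *: e - g x y = (- (g x y - d *: e) - s *: e) + s *: e.
    by rewrite subrK opprB.
  by apply: Kadd => //; apply: Ksc => //; exact: ltW.
pose u1 := Dual (positive_continuous Ke lK).
have [|c [w [c0 hw w1]]] := @normalize_dual _ _ u1 e.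
  by rewrite /u1/= le oner_neq0.
exists w; split => //.
  by move=> z Kz; rewrite hw mulr_ge0// ?(ltW c0)//; exact: (lK z Kz).
apply: (@lt_le_trans _ _ (c * d)%:E); first by rewrite lte_fin mulr_gt0.
apply: le_ereal_inf_tmp => _ [x Xx <-]; rewrite lee_fin hw ler_pM2l//.
by have := lphi _ Xx; rewrite linearB linearZ/= le /GRing.scale/=; lra.
Qed.

End Duality.

(** * Finite sets: minimizers, and finiteness from compactness *)

Lemma finite_argmin (R : realType) (T : Type) (A : set T) (F : T -> R) :
  finite_set A -> A !=set0 -> exists2 a, A a & forall b, A b -> F a <= F b.
Proof.
move=> finA [a0 Aa0].
have [||_ /set_mem[a Aa <-] hmin] := @compact_EVT_min _ R id _
    (ex_intro _ (F a0) (imageP F Aa0)).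
- exact/finite_compact/finite_image.
- by apply: continuous_subspaceT => x.
by exists a => // b Ab; apply: hmin; apply/mem_set; exists b.
Qed.

(** The complement of the closure of [A] minus [x] is open and meets [A] only at [x], so a finite
    subcover by such sets enumerates [A]. *)
Lemma compact_isolated_finite (T : ptopologicalType) (A : set T) :
  compact A -> (forall x, A x -> isolated A x) -> finite_set A.
Proof.
rewrite compact_cover => cA iA.
have [||F FA AF] := cA T A (fun x => ~` closure (A `\ x)).
- by move=> x Ax; apply: closed_openC; exact: closed_closure.
- move=> x Ax; exists x => //= cx.
  have [_ [V Vx VA]] := iA _ Ax.
  have [z [[Az zx] Vz]] := cx _ Vx.
  have : [set x] z by rewrite -VA.
  exact: zx.
apply: (sub_finite_set _ (finite_fset F)) => z Az.
have [x Fx /= nz] := AF _ Az.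
suff -> : z = x by [].
by apply: contrapT => zx; apply: nz; apply: subset_closure.
Qed.

(** * Termination by counting cuts *)

Section Algorithm.
Context {R : realType} {E Z : completeNormedModType R} {D : normedModType R}.
Variables (X : set E) (Y : set D) (K : set Z) (f : E -> D -> R) (g : E -> D -> Z).
Variable eps : R.
Hypothesis eps_gt0 : 0 < eps.

Local Notation dual_value u y := (ereal_inf [set (lagrangian f g u x y)%:E | x in X]).

(* The termination measure: every new cut removes the current master solution
   from this set. *)
Definition open_params (s : @state R Z) : set D := [set y |
  exists2 eta, master_feasible X Y f g s y eta &
    ((eta + eps)%:E < value X K f g y)%E].

(** The index bounds make [(iter_nb s).+1] fresh, a nonempty [opt_idx] bounds [eta] below, and
    positivity of the feasibility functionals keeps feasible parameters in the master problem. *)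
Definition well_formed (s : @state R Z) :=
  [/\ opt_idx s !=set0,
      forall i, opt_idx s i -> (i <= iter_nb s)%N,
      forall j, feas_idx s j -> (j <= iter_nb s)%N &
      forall j, feas_idx s j -> dual_cone K (zstar s j)].

Definition invariant (c : @config R Z D) :=
  match c with
  | Step1 y1 z1 => feasible_params X Y K g y1 /\ dual_cone K z1
  | Step2 s => well_formed s
  | Step3 s y eta => well_formed s /\ master_optimal X Y f g s y eta
  | Terminated => True
  end.

Lemma invariant_transition c c' : invariant c ->
  transition X Y K f g eps c c' -> invariant c'.
Proof.
move=> + cc'; case: cc' => //=.
- move=> y1 z1 u1 _ [_ z1K]; split => //=; first by exists 1%N.
  + by move=> i ->.
  + by move=> j ->.
- move=> s y eta w _ _ _ [[[i0 Ti0] Tle Sle SK] _]; split => //=.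
  + by exists i0; left.
  + by move=> i [/Tle/leqW//|->].
  + by move=> j /Sle/leqW.
- move=> s y eta w _ wK _ _ [[T0 Tle Sle SK] _]; split => //=.
  + by move=> i /Tle/leqW.
  + by move=> j [/Sle/leqW//|->].
  + by move=> j; case: eqP => [|jk [/SK//|/jk]].
Qed.

(** The new index exceeds all old ones, so updating [ustar] overwrites no existing cut. *)
Lemma add_optimality_cut_feasible s y w y' eta : well_formed s ->
  master_feasible X Y f g (add_optimality_cut X K f g s y w) y' eta ->
  master_feasible X Y f g s y' eta /\ (dual_value w y' <= eta%:E)%E.
Proof.
move=> [_ Tle _ _] [/= Yy' opt feas]; split; last first.
  by have := opt (iter_nb s).+1 (or_intror erefl); rewrite eqxx.
split => // i Ti; have := opt i (or_introl Ti).
by rewrite lt_eqF// ltEnat/= ltnS Tle.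
Qed.

Lemma add_feasibility_cut_feasible s (w : dual Z) y' eta : well_formed s ->
  master_feasible X Y f g (add_feasibility_cut s w) y' eta ->
  master_feasible X Y f g s y' eta /\
  (ereal_inf [set (w (g x y'))%:E | x in X] <= 0)%E.
Proof.
move=> [_ _ Sle _] [/= Yy' opt feas]; split; last first.
  by have := feas (iter_nb s).+1 (or_intror erefl); rewrite eqxx.
split => // j Sj; have := feas j (or_introl Sj).
by rewrite lt_eqF// ltEnat/= ltnS Sle.
Qed.

(** By complementarity the Lagrangian at its minimizer [xbar] equals [f xbar y], and [xbar] is
    feasible. *)
Lemma value_le_dual_value y u : multipliers X K f g y u ->
  (value X K f g y <= dual_value u y)%E.
Proof.
move=> [xbar Xxbar [lmin ug uK gxbar]].
apply: le_ereal_inf_tmp => _ [x Xx <-].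
apply: (@le_trans _ _ (f xbar y)%:E).
  by apply: ereal_inf_lbound; exists xbar.
by rewrite lee_fin; have := lmin _ Xx; rewrite {1}/lagrangian ug addr0.
Qed.

(** The current [y] is open before the cut because the stopping test failed; afterwards any
    admissible [eta'] at [y] is at least the value, which closes the gap. *)
Lemma open_params_optimality_cut s y eta w : well_formed s ->
  master_feasible X Y f g s y eta ->
  ~ (value X K f g y <= (eta + eps)%:E)%E -> multipliers X K f g y w ->
  open_params (add_optimality_cut X K f g s y w) `<` open_params s.
Proof.
move=> ws sy gap yw; split.
  by move=> y' [eta' /(add_optimality_cut_feasible ws)[h _] ?]; exists eta'.
have ys : open_params s y by exists eta => //; rewrite ltNge; apply/negP.
move=> /(_ _ ys)[eta' /(add_optimality_cut_feasible ws)[_ h]].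
apply/negP; rewrite -leNgt (le_trans (value_le_dual_value yw))// (le_trans h)//.
by rewrite lee_fin lerDl ltW.
Qed.

Lemma open_params_feasibility_cut s y eta (w : dual Z) : well_formed s ->
  master_feasible X Y f g s y eta -> value X K f g y = +oo%E ->
  (0 < ereal_inf [set (w (g x y))%:E | x in X])%E ->
  open_params (add_feasibility_cut s w) `<` open_params s.
Proof.
move=> ws sy vy wy; split.
  by move=> y' [eta' /(add_feasibility_cut_feasible ws)[h _] ?]; exists eta'.
have ys : open_params s y by exists eta => //; rewrite vy ltry.
move=> /(_ _ ys)[eta' /(add_feasibility_cut_feasible ws)[_ h]] _.
by move: wy; rewrite ltNge h.
Qed.

Hypothesis Y_finite : finite_set Y.

Hypothesis progress : forall c, invariant c -> c <> Terminated ->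
  exists c', transition X Y K f g eps c c'.

(** By [progress], a non-terminating execution never stutters, so it returns to Step 2 forever, each
    return strictly shrinking a finite set. *)
Lemma finite_termination : terminates_finitely X Y K f g eps.
Proof.
move=> c [[y1 [z1 [y1V z1K z11 c0]]] step].
have inv n : invariant (c n).
  elim: n => [|n IH]; first by rewrite c0.
  by have [/(invariant_transition IH)//|[_ ->]] := step n.
have [//|notT] := pselect (exists n, c n = Terminated).
have tr n : transition X Y K f g eps (c n) (c n.+1).
  have [//|[stuck _]] := step n.
  have [|c' /stuck//] := progress (inv n).
  by move=> cn; apply: notT; exists n.
have open_fin s : finite_set (open_params s).
  by apply: sub_finite_set Y_finite => y [eta []].
(* Induction on a strict bound for the number of open parameters; one round consists of two
   transitions. *)
have noStep2 m : forall n s, c n = Step2 s ->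
    (#|` fset_set (open_params s)| < m)%N -> False.
  elim: m => // m IH n s cn sm.
  have ws : well_formed s by have := inv n; rewrite cn.
  have shrink s' : open_params s' `<` open_params s ->
      (#|` fset_set (open_params s')| < m)%N.
    move=> ss'; rewrite -ltnS (leq_trans _ sm)// ltnS.
    apply: fproper_ltn_card; rewrite fproperEneq; apply/andP; split.
      apply/eqP => ff; case: ss' => _; apply.
      by rewrite -(fset_setK (open_fin s)) -ff fset_setK.
    by rewrite -fset_set_sub//; case: ss'.
  have [y [eta [opt cn1]]] : exists y eta,
      master_optimal X Y f g s y eta /\ c n.+1 = Step3 s y eta.
    have := tr n; rewrite cn => t; inversion t; [by case: notT; exists n.+1|].
    by exists y, eta.
  have [sy _] := opt.
  have := tr n.+1; rewrite cn1 => t; inversion t.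
  - by apply: notT; exists n.+2.
  - apply: (IH n.+2 (add_optimality_cut X K f g s y w)) => //.
    apply: shrink; exact: (open_params_optimality_cut ws sy).
  - apply: (IH n.+2 (add_feasibility_cut s w)) => //.
    apply: shrink; exact: (open_params_feasibility_cut ws sy).
have := tr 0%N; rewrite c0 => t; inversion t.
by case: (noStep2 _ 1%N _ (esym H2) (ltnSn _)).
Qed.

End Algorithm.

(** * Solvability of the relaxed master problem *)

Section Master.
Context {R : realType} {E Z : completeNormedModType R} {D : normedModType R}.
Variables (X : set E) (Y : set D) (K : set Z) (f : E -> D -> R) (g : E -> D -> Z).
Hypotheses (X_compact : compact X) (Y_finite : finite_set Y).
Hypothesis f_cont : forall y, Y y -> {within X, continuous (fun x => f x y)}.
Hypothesis g_cont : forall y, Y y -> {within X, continuous (fun x => g x y)}.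

(** The Lagrangian is continuous on the compact [X], so its infimum is attained; optimality cuts
    become real inequalities. *)
Lemma dual_value_fin u y : X !=set0 -> Y y ->
  exists r : R, ereal_inf [set (lagrangian f g u x y)%:E | x in X] = r%:E.
Proof.
move=> X0 Yy.
have lc : {within X, continuous (fun x => lagrangian f g u x y)}.
  move=> x; apply: (@cvgD _ R^o); first exact: f_cont.
  by apply: (continuous_comp (g_cont Yy (x := x))); exact: (@dual_continuous _ _ u).
have [xm /set_mem Xxm hm] := compact_EVT_min X0 X_compact lc.
exists (lagrangian f g u xm y); apply/eqP; rewrite eq_le; apply/andP; split.
  by apply: ereal_inf_lbound; exists xm.
by apply: le_ereal_inf_tmp => _ [x Xx <-]; rewrite lee_fin hm//; exact/mem_set.
Qed.

(* A feasible parameter violates no feasibility cut. *)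
Lemma master_optimal_exists s y0 x0 : Y y0 -> X x0 -> cone_le K (g x0 y0) 0 ->
  well_formed K s -> exists y eta, master_optimal X Y f g s y eta.
Proof.
move=> Yy0 Xx0 gx0 [T0 Tle Sle SK].
have X0 : X !=set0 by exists x0.
have T_fin : finite_set (opt_idx s).
  by apply: (sub_finite_set _ (finite_II (iter_nb s).+1)) => i /Tle.
pose cuts_ok := [set y | Y y /\ forall j, feas_idx s j ->
  (ereal_inf [set (zstar s j (g x y))%:E | x in X] <= 0)%E].
have best y : Y y -> exists r : R, forall eta,
    (forall i, opt_idx s i ->
      (ereal_inf [set (lagrangian f g (ustar s i) x y)%:E | x in X] <= eta%:E)%E) <->
    r <= eta.
  move=> Yy.
  have /choice[c hc] : forall i, exists r : R,
      ereal_inf [set (lagrangian f g (ustar s i) x y)%:E | x in X] = r%:E.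
    by move=> i; exact: dual_value_fin.
  have [i0 Ti0 hi0] := finite_argmin (fun i => - c i) T_fin T0.
  exists (c i0) => eta; split => [/(_ _ Ti0)|ceta i Ti]; rewrite hc lee_fin//.
  by rewrite (le_trans _ ceta)// -lerN2 hi0.
have /choice[r hr] : forall y, exists r : R, Y y -> forall eta,
    (forall i, opt_idx s i ->
      (ereal_inf [set (lagrangian f g (ustar s i) x y)%:E | x in X] <= eta%:E)%E) <->
    r <= eta.
  move=> y; have [/best[r hr]|nY] := pselect (Y y); first by exists r.
  (* An arbitrary default outside [Y], so that [r] is a total function. *)
  by exists 0.
have cuts_fin : finite_set cuts_ok by apply: sub_finite_set Y_finite => y [].
have [|y [Yy cy] ymin] := finite_argmin r cuts_fin.
  exists y0; split => // j /SK jK; apply: ge_ereal_inf.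
  exists (zstar s j (g x0 y0))%:E; first by exists x0.
  by have := jK _ gx0; rewrite sub0r linearN lee_fin; lra.
exists y, (r y); split; first by split => //; exact/hr.
move=> y' eta' [Yy' opt' feas']; apply: (@le_trans _ _ (r y')); first exact: ymin.
exact/hr.
Qed.

End Master.

(** * Every configuration before termination can move *)

Theorem theorem4p4 (R : realType) (E Z : completeNormedModType R)
    (D : normedModType R)
    (X : set E) (Y : set D) (K : set Z) (f : E -> D -> R) (g : E -> D -> Z)
    (X_closed : closed X) (X_convex : convex_set X)
    (Y_discrete : forall y, Y y -> isolated Y y)
    (K_closed : closed K) (K_convex : convex_set K) (K_cone : is_cone K)
    (K_int : interior K !=set0)
    (f_convex : forall y, Y y -> convex_function X (fun x => f x y))
    (g_convex : forall y, Y y -> cone_convex K X (fun x => g x y))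
    (slater : forall y, feasible_params X Y K g y ->
       exists2 xhat, X xhat & cone_lt K (g xhat y) 0)
    (X_compact : compact X) (Y_compact : compact Y)
    (f_cont : {within X `*` Y, continuous (fun p : E * D => f p.1 p.2)})
    (g_cont : {within X `*` Y, continuous (fun p : E * D => g p.1 p.2)})
    (U_loc_bounded : forall y, feasible_params X Y K g y ->
       locally_bounded_at (feasible_params X Y K g) (multipliers X K f g) y)
    (eps : R) (eps_gt0 : 0 < eps) :
  terminates_finitely X Y K f g eps.
Proof.
have Y_finite := compact_isolated_finite Y_compact Y_discrete.
have [e Ke] := K_int.
have fc y : Y y -> {within X, continuous (fun x => f x y)}.
  by move=> Yy; exact: (continuous_within_section (W := R^o) f_cont).
have gc y : Y y -> {within X, continuous (fun x => g x y)}.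
  by move=> Yy; exact: continuous_within_section g_cont Yy.
have mult y : feasible_params X Y K g y -> exists u, multipliers X K f g y u.
  move=> yV; have [xhat Xxhat sl] := slater _ yV; have [Yy [x0 hx0]] := yV.
  exact: (multiplier_exists X_closed X_convex X_compact K_closed K_convex K_cone
    Ke (f_convex _ Yy) (g_convex _ Yy) (fc _ Yy) (gc _ Yy) Xxhat sl hx0).
move=> c cexec; apply: (@finite_termination _ _ _ _ X Y K f g eps eps_gt0) => //.
(* The starting parameter of Step 1 supplies the feasible pair that keeps every master problem
   feasible and [X] nonempty. *)
have [[y0 [z0 [[Yy0 [x0 [Xx0 gx0]]] _ _ _]]] _] := cexec.
have X0 : X !=set0 by exists x0.
move=> {cexec}-[y1 z1 [/mult[u1 hu1] z1K] _|s ws _|s y eta [ws [sy _]] _|_ //].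
- by exists (Step2 (start_state X K f g y1 z1 u1)); exact: Step1_multiplier.
- have [y [eta opt]] : exists y eta, master_optimal X Y f g s y eta.
    exact: (master_optimal_exists X_compact Y_finite fc gc Yy0 Xx0 gx0 ws).
  have [stop|cont] := pselect (UBD s <= (eta + eps)%:E)%E.
    by exists Terminated; exact: Step2_stop opt stop.
  by exists (Step3 s y eta); exact: Step2_continue.
have Yy : Y y by case: sy.
have [vy|vy] := eqVneq (value X K f g y) +oo%E.
  have [|w [wK w1 wg]] := infeasibility_certificate X_convex X_compact K_closed
    K_convex K_cone Ke (g_convex _ Yy) (gc _ Yy) X0.
    move=> x hx; have : (value X K f g y <= (f x y)%:E)%E.
      by apply: ereal_inf_lbound; exists x.
    by rewrite vy.
  by exists (Step2 (add_feasibility_cut s w)); exact: Step3b.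
have {}vy : (value X K f g y < +oo)%E by rewrite ltey.
have [stop|cont] := pselect (value X K f g y <= (eta + eps)%:E)%E.
  by exists Terminated; exact: Step3a_stop.
(* A value below [+oo] is the infimum of a nonempty set, so [y] is feasible and [mult] applies. *)
have [_ [x hx _] _] := ereal_inf_lt vy.
have [|w hw] := mult y; first by split => //; exists x.
by exists (Step2 (add_optimality_cut X K f g s y w)); exact: Step3a_continue.
Qed.
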